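(* Let $F:\mathbb{R}^n\rightrightarrows\mathbb{R}^n$ be an upper semicontinuous set-valued map taking nonempty, convex, and compact values at every point $x\in\mathbb{R}^n$. Consider the differential inclusion $\dot x\in F(x)$ and let $t\mapsto\varphi(t)$ be a bounded solution whose omega-limit set $\Omega(\varphi)$ is contained in $\mathcal{S}\subset\mathbb{R}^n$, a closed embedded submanifold of $\mathbb{R}^n$. Let $\mathcal{O}$ be an open neighborhood of $\mathcal{S}$ on which a locally Lipschitz, regular function $W:\mathcal{O}\to\mathbb{R}$ is defined. Assume that: (i) the set $\mathcal{E}=\{x\in\mathcal{S}\mid 0\in\mathcal{L}_FW(x)\}$ belongs to a level set of $W$ (i.e., $W$ is constant on $\mathcal{E}$); (ii) for any compact set $\mathcal{M}\subset\mathcal{S}$ with $\mathcal{M}\cap\mathcal{E}=\emptyset$, there exist a compact neighborhood $\mathcal{M}_c$ of $\mathcal{M}$ in $\mathbb{R}^n$ (contained in $\mathcal{O}$) and $\delta<0$ such that $\sup_{x\in\mathcal{M}_c}\max\mathcal{L}_FW(x)\le\delta$. Then $\Omega(\varphi)\subset\mathcal{E}$.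
   Context: A set-valued map $F$ is upper semicontinuous at $x$ if for all $\epsilon>0$ there is $\delta>0$ such that $F(y)\subset F(x)+B(0,\epsilon)$ for all $y\in B(x,\delta)$. A solution of $\dot x\in F(x)$ is a locally absolutely continuous map $\varphi:[0,\infty)\to\mathbb{R}^n$ satisfying $\dot\varphi(t)\in F(\varphi(t))$ for almost all $t\ge0$. The omega-limit set $\Omega(\varphi)$ is the set of all $y\in\mathbb{R}^n$ for which there is a sequence $t_k\to\infty$ with $\varphi(t_k)\to y$. For a locally Lipschitz $W$, $\partial W$ is the (Clarke) generalized gradient, $\partial W(x)=\mathrm{co}\{\lim_i\nabla W(x_i)\mid x_i\to x,\ x_i\notin S\cup\Omega_W\}$, where $\Omega_W$ is the null set of points where $W$ is not differentiable and $S$ is any null set. $W$ is regular at $x$ if for all directions $v$ the right directional derivative of $W$ at $x$ in direction $v$ exists and coincides with the (Clarke) generalized directional derivative. The set-valued Lie derivative of $W$ with respect to $F$ is $$\mathcal{L}_FW(x)=\{a\in\mathbb{R}\mid \exists v\in F(x)\text{ such that }\zeta^\top v=a\text{ for all }\zeta\in\partial W(x)\},$$ which may be empty; the convention $\max\emptyset=-\infty$ is used. *)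

(* Defs.v *)
From HB Require Import structures.
From mathcomp Require Import all_boot all_order all_algebra.
From mathcomp Require Import all_classical all_reals all_analysis.
Set Implicit Arguments.
Unset Strict Implicit.
Unset Printing Implicit Defensive.
Import Order.TTheory GRing.Theory Num.Theory.
Import numFieldNormedType.Exports.
Local Open Scope classical_set_scope.
Local Open Scope ring_scope.

(* R^n is 'rV[R]_n with the library's norm, which is the maximum norm. The
   notions below that mention the norm or its balls are the same for all the
   equivalent norms. *)

Definition dotp (R : realType) (n : nat) (u v : 'rV[R]_n) : R :=
  \sum_(i < n) u 0 i * v 0 i.

Definition upper_semicontinuous (R : realType) (n : nat)
    (F : 'rV[R]_n -> set 'rV[R]_n) (x : 'rV[R]_n) : Prop :=
  forall eps : R, 0 < eps -> exists2 delta : R, 0 < delta &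
    forall y, ball x delta y ->
      F y `<=` [set u + w | u in F x & w in ball (0 : 'rV[R]_n) eps].

Definition absolutely_continuous_on (R : realType) (n : nat) (a b : R)
    (phi : R -> 'rV[R]_n) : Prop :=
  forall eps : R, 0 < eps -> exists2 delta : R, 0 < delta &
    forall (m : nat) (s t : 'I_m -> R),
      (forall i, a <= s i /\ s i <= t i /\ t i <= b) ->
      trivIset [set: 'I_m] (fun i => `]s i, t i[%classic) ->
      \sum_(i < m) (t i - s i) < delta ->
      \sum_(i < m) `|phi (t i) - phi (s i)| < eps.

(* A map defined on [0, +oo[ is represented by a map on R; its values at
   negative times are irrelevant. *)
Definition is_solution (R : realType) (n : nat)
    (F : 'rV[R]_n -> set 'rV[R]_n) (phi : R -> 'rV[R]_n) : Prop :=
  (forall T : R, 0 < T -> absolutely_continuous_on 0 T phi) /\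
  {ae (@lebesgue_measure R), forall t : R, 0 <= t ->
    derivable phi t 1 /\ F (phi t) (derive1 phi t)}.

Definition omega_limit (R : realType) (n : nat) (phi : R -> 'rV[R]_n) :
    set 'rV[R]_n :=
  [set y | exists t : nat -> R, [/\ forall k, 0 <= t k,
      t k @[k --> \oo] --> +oo & phi (t k) @[k --> \oo] --> y]].

Fixpoint Ck_on (R : realType) (n : nat) (V : normedModType R) (k : nat)
    (U : set 'rV[R]_n) (f : 'rV[R]_n -> V) : Prop :=
  if k is k'.+1 then
    forall i : 'I_n,
      (forall x, U x -> derivable f x (delta_mx 0 i)) /\
      Ck_on k' U (fun x => 'D_(delta_mx 0 i) f x)
  else forall x, U x -> {for x, continuous f}.

Definition smooth_on (R : realType) (n : nat) (V : normedModType R)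
    (U : set 'rV[R]_n) (f : 'rV[R]_n -> V) : Prop :=
  forall k : nat, Ck_on k U f.

Definition diffeomorphism_on (R : realType) (n : nat) (U V : set 'rV[R]_n)
    (f g : 'rV[R]_n -> 'rV[R]_n) : Prop :=
  [/\ open U, open V, smooth_on U f, smooth_on V g &
      [/\ forall x, U x -> V (f x), forall y, V y -> U (g y),
          forall x, U x -> g (f x) = x & forall y, V y -> f (g y) = y]].

(* Local slice condition: near each of its points, S is straightened by a
   diffeomorphism to the slice R^k x {0} of R^n. *)
Definition embedded_submanifold (R : realType) (n : nat)
    (S : set 'rV[R]_n) : Prop :=
  exists2 k : nat, (k <= n)%N & forall p, S p ->
    exists U V f g, [/\ U p, diffeomorphism_on U V f g &
      forall x, U x ->
        (S x <-> forall i : 'I_n, (k <= i)%N -> f x 0 i = 0)].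

(* The volumes of a countable family of boxes covering A sum up to at most
   eps; the index set D allows finite (in particular, empty) families. *)
Definition lebesgue_null (R : realType) (n : nat) (A : set 'rV[R]_n) : Prop :=
  forall eps : R, 0 < eps -> exists (D : set nat) (a b : nat -> 'rV[R]_n),
    [/\ forall j i, a j 0 i <= b j 0 i,
        A `<=` \bigcup_(j in D)
                 [set x | forall i, a j 0 i <= x 0 i <= b j 0 i] &
        (\esum_(j in D) (\prod_(i < n) (b j 0 i - a j 0 i))%:E <= eps%:E)%E].

(* A function W defined on an open set is represented by a function on R^n;
   all the notions below are local, so that at a point of that open set they do
   not depend on the values of W elsewhere. *)

Definition locally_lipschitz_on (R : realType) (n : nat) (O : set 'rV[R]_n)
    (W : 'rV[R]_n -> R) : Prop :=
  forall x, O x -> exists2 U, nbhs x U & [lipschitz W y | y in U].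

Definition gradient (R : realType) (n : nat) (W : 'rV[R]_n -> R)
    (x : 'rV[R]_n) : 'rV[R]_n :=
  \row_(i < n) 'D_(delta_mx 0 i) W x.

Definition convex_hull (R : realType) (n : nat) (A : set 'rV[R]_n) :
    set 'rV[R]_n :=
  smallest (fun B : set 'rV[R]_n => convex_set B) A.

(* N is the auxiliary null set that the sequences avoid in addition to the
   points of nondifferentiability of W. *)
Definition clarke_gradient (R : realType) (n : nat) (N : set 'rV[R]_n)
    (W : 'rV[R]_n -> R) (x : 'rV[R]_n) : set 'rV[R]_n :=
  convex_hull [set z | exists u : nat -> 'rV[R]_n,
    [/\ u k @[k --> \oo] --> x,
        forall k, ~ N (u k) /\ differentiable W (u k) &
        gradient W (u k) @[k --> \oo] --> z]].

(* limsup of (W (y + h v) - W y) / h as y --> x and h --> 0, h > 0 *)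
Definition clarke_derivative (R : realType) (n : nat) (W : 'rV[R]_n -> R)
    (x v : 'rV[R]_n) : \bar R :=
  limf_esup (fun p : 'rV[R]_n * R => ((W (p.1 + p.2 *: v) - W p.1) / p.2)%:E)
    (filter_prod (nbhs x) (0 : R)^'+).

Definition regular_at (R : realType) (n : nat) (W : 'rV[R]_n -> R)
    (x : 'rV[R]_n) : Prop :=
  forall v : 'rV[R]_n, exists2 l : R,
    (W (x + h *: v) - W x) / h @[h --> (0 : R)^'+] --> l &
    clarke_derivative W x v = l%:E.

Definition lie_derivative (R : realType) (n : nat) (N : set 'rV[R]_n)
    (F : 'rV[R]_n -> set 'rV[R]_n) (W : 'rV[R]_n -> R) (x : 'rV[R]_n) : set R :=
  [set a | exists2 v, F x v & forall z, clarke_gradient N W x z -> dotp z v = a].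

(* For F compact-valued and W locally Lipschitz, the Lie derivative is a compact
   set of reals: the supremum is its maximum, or -oo if it is empty. *)
Definition max_lie_derivative (R : realType) (n : nat) (N : set 'rV[R]_n)
    (F : 'rV[R]_n -> set 'rV[R]_n) (W : 'rV[R]_n -> R) (x : 'rV[R]_n) : \bar R :=
  ereal_sup (EFin @` lie_derivative N F W x).

(* Main.v *)
Require Import Defs.
From HB Require Import structures.
From mathcomp Require Import all_boot all_order all_algebra.
From mathcomp Require Import all_classical all_reals all_analysis.
From mathcomp Require Import ring lra.
Set Implicit Arguments.
Unset Strict Implicit.
Unset Printing Implicit Defensive.
Import Order.TTheory GRing.Theory Num.Theory.
Import numFieldNormedType.Exports.
Local Open Scope classical_set_scope.
Local Open Scope ring_scope.

(** Let g = W o phi. At almost every t, phi has a velocity v in F (phi t), and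
    by regularity g has the one-sided derivatives W°(phi t; v) and
    - W°(phi t; - v). These differ at most countably often, and where they
    agree, the inequalities z.v <= W°(phi t; v) and - z.v <= W°(phi t; - v) for
    z in the Clarke gradient force g' t into the Lie derivative. Hence g
    decreases at a uniform rate as long as phi stays in the neighborhood given
    by (ii).

    Let W = c on E. For k > 0, applying (ii) to the part of Omega where
    |W - c| >= k shows that g eventually decreases at a uniform rate whenever
    |g - c| >= k. As g does not tend to -oo, this gives g --> c. If some y in
    Omega were not in E, then (ii) with M = {y} would make g drop by a fixed
    amount at each of the infinitely many visits of phi near y, since the
    speed of phi is bounded there: a contradiction. *)

(** * Induction along a compact real interval *)

(** Real induction: at the supremum of the points reached from [a], the local hypothesis leads past
    that supremum unless it equals [b]. *)
Lemma additive_segment (R : realType) (P : R -> R -> Prop) (a b : R) :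
  a <= b ->
  (forall u v w, a <= u -> u <= v -> v <= w -> w <= b ->
    P u v -> P v w -> P u w) ->
  (forall t, a <= t <= b -> exists2 r : R, 0 < r &
    forall u v, a <= u -> u <= t -> t <= v -> v <= b -> v - u < r -> P u v) ->
  P a b.
Proof.
move=> leab Padd Ploc.
pose A := [set s | a <= s <= b /\ P a s].
have Aa : A a.
  split; first by rewrite lexx.
  have [|r r0] := Ploc a; first by rewrite lexx.
  by apply; rewrite ?lexx ?subrr.
have ubA : ubound A b by move=> s [/andP[]].
have supA : has_sup A by split; [exists a | exists b].
have ub_sup : forall s, A s -> s <= sup A by exact: sup_upper_bound.
have a_le : a <= sup A by exact: ub_sup.
have le_b : sup A <= b by apply: ge_sup => //; exists a.
have [|r r0 Pr] := Ploc (sup A); first by rewrite a_le.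
have r2 : 0 < r / 2 by rewrite divr_gt0.
have [s As lts] := sup_adherent r2 supA.
have les := ub_sup _ As; case: As => /andP[leas lesb] Pas.
pose v := Num.min b (sup A + r / 3).
have lev : sup A <= v by rewrite le_min le_b lerDl ltW// divr_gt0.
have vb : v <= b by rewrite ge_min lexx.
have vr : v <= sup A + r / 3 by rewrite ge_min lexx orbT.
have Pav : P a v.
  apply: (Padd a s v) => //; first exact: le_trans lev.
  apply: Pr => //; lra.
have /ub_sup vs : A v by split; rewrite // (le_trans a_le lev).
suff -> : b = v by [].
by rewrite /v in vs *; case: (leP b (sup A + r / 3)) vs => // _ vs; lra.
Qed.

(** If [l < h b], continuity forces [h = l] at the last point where [h <= l], and the local
    hypothesis then produces a later such point. *)
Lemma le_barrier (R : realType) (h : R -> R) (a b l : R) :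
  a <= b -> h a <= l ->
  (forall t, a <= t <= b -> {for t, continuous h}) ->
  (forall t, a <= t < b -> h t = l ->
    exists2 r : R, 0 < r & forall v, t <= v < t + r -> v <= b -> h v <= l) ->
  h b <= l.
Proof.
move=> leab ha ch hloc; rewrite leNgt; apply/negP => hb.
pose A := [set s | a <= s <= b /\ h s <= l].
have Aa : A a by rewrite /A/= lexx leab.
have ubA : ubound A b by move=> s [/andP[]].
have supA : has_sup A by split; [exists a | exists b].
have ub_sup : forall s, A s -> s <= sup A by exact: sup_upper_bound.
have a_le : a <= sup A by exact: ub_sup.
have le_b : sup A <= b by apply: ge_sup => //; exists a.
have cs := ch (sup A); rewrite a_le le_b in cs.
have {}cs : h @ sup A --> h (sup A) := cs isT.
have hs_le : h (sup A) <= l.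
  rewrite leNgt; apply/negP => H.
  have /nbhs_ballP[r /= r0 br] : \forall t \near sup A, l < h t.
    exact: (cs _ (lt_nbhsr H)).
  have [s As lts] := sup_adherent r0 supA.
  have := br s; rewrite /ball/= ltr_distl.
  have := ub_sup _ As; case: As => _ hs ss.
  by move=> /(_ _)/wrap[|]; [lra | rewrite ltNge hs].
have lt_b : sup A < b.
  rewrite lt_neqAle le_b andbT; apply/eqP => eb; move: hb; rewrite -eb; lra.
have hs_ge : l <= h (sup A).
  rewrite leNgt; apply/negP => H.
  have /nbhs_ballP[r /= r0 br] : \forall t \near sup A, h t < l.
    exact: (cs _ (lt_nbhsl H)).
  pose v := Num.min b (sup A + r / 2).
  have vb : v <= b by rewrite ge_min lexx.
  have vs : sup A < v by rewrite lt_min lt_b; lra.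
  have vr : v <= sup A + r / 2 by rewrite ge_min lexx orbT.
  have : A v.
    split; first by rewrite vb andbT; lra.
    by apply/ltW/br; rewrite /ball/= ltr_distl; apply/andP; split; lra.
  by move/ub_sup; lra.
have [||r r0 hr] := hloc (sup A); [by rewrite a_le|lra|].
pose v := Num.min b (sup A + r / 2).
have vb : v <= b by rewrite ge_min lexx.
have vs : sup A < v by rewrite lt_min lt_b; lra.
have vr : v <= sup A + r / 2 by rewrite ge_min lexx orbT.
have : A v by split; [rewrite vb andbT; lra | apply: hr; rewrite // ltW//; lra].
by move/ub_sup; lra.
Qed.

(** * Points where the one-sided derivatives differ *)

(** Here [- l2] is the left derivative. A rational slope [q] strictly between [- l2] and [l1] makes
    [t] the strict minimum of [f s - q * s] on an interval with rational endpoints, and two points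
    cannot share the same three rationals. *)
Lemma countable_left_derivative_lt_right (R : realType) (f : R -> R) :
  countable [set t | exists l1 l2 : R, [/\
    (f (t + h) - f t) / h @[h --> (0 : R)^'+] --> l1,
    (f (t - h) - f t) / h @[h --> (0 : R)^'+] --> l2 & 0 < l1 + l2]].
Proof.
set A := [set t | _].
pose Q t (p : rat * (rat * rat)) : Prop :=
  ratr p.2.1 < t < ratr p.2.2 /\ forall s, ratr p.2.1 < s < ratr p.2.2 ->
   s != t -> f t - ratr p.1 * t < f s - ratr p.1 * s.
have AQ t : exists p, A t -> Q t p.
  have [At|] := pselect (A t); last by exists (0, (0, 0)).
  have [l1 [l2 [/= c1 c2 l12]]] := At.
  have [|q /itvP ql] := @rat_in_itvoo _ (- l2) l1; first lra.
  have /nbhs_ballP[r1 /= r10 n1] : \forall h \near (0:R)^'+,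
      ratr q < (f (t + h) - f t) / h.
    by apply: (c1 _ (lt_nbhsr _)); rewrite ql.
  have /nbhs_ballP[r2 /= r20 n2] : \forall h \near (0:R)^'+,
      - ratr q < (f (t - h) - f t) / h.
    by apply: (c2 _ (lt_nbhsr _)); rewrite ltrNl ql.
  pose r := Num.min r1 r2.
  have r0 : 0 < r by rewrite lt_min r10.
  have rr1 : r <= r1 by rewrite ge_min lexx.
  have rr2 : r <= r2 by rewrite ge_min lexx orbT.
  have [|c1' /itvP p1] := @rat_in_itvoo _ (t - r) t; first lra.
  have [|c2' /itvP p2] := @rat_in_itvoo _ t (t + r); first lra.
  exists (q, (c1', c2')) => _; split => /=; first by rewrite p1 p2.
  move=> s /andP[s1 s2] /eqP st.
  have p1' : t - r < ratr c1' by rewrite p1.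
  have p2' : ratr c2' < t + r by rewrite p2.
  have [ts|ts|/esym//] := ltgtP t s.
    have := n1 (s - t); rewrite /ball/= sub0r normrN gtr0_norm ?subr_gt0//.
    move=> /(_ _)/wrap[|]; first lra.
    move=> /(_ ts); rewrite ltr_pdivlMr ?subr_gt0// (addrC t) subrK; lra.
  have := n2 (t - s); rewrite /ball/= sub0r normrN gtr0_norm ?subr_gt0//.
  move=> /(_ _)/wrap[|]; first lra.
  move=> /(_ ts); rewrite ltr_pdivlMr ?subr_gt0//.
  rewrite (_ : t - (t - s) = s); [lra|ring].
have [g gQ] := choice AQ.
apply/countable_injP; exists (pickle \o g) => s t /set_mem As /set_mem At /=.
move/(pcan_inj pickleK) => gst; apply/eqP; apply: contraT => st.
have [Qs1 Qs2] := gQ _ As; have [Qt1 Qt2] := gQ _ At; rewrite -gst in Qt1 Qt2.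
have := Qs2 _ Qt1; rewrite eq_sym st => /(_ isT).
have := Qt2 _ Qs1; rewrite st => /(_ isT); lra.
Qed.

Lemma negligible_one_sided_derivatives_neq (R : realType) (f : R -> R) :
  (@lebesgue_measure R).-negligible [set t | exists l1 l2 : R, [/\
    (f (t + h) - f t) / h @[h --> (0 : R)^'+] --> l1,
    (f (t - h) - f t) / h @[h --> (0 : R)^'+] --> l2 & l1 + l2 != 0]].
Proof.
have cneg (A : set R) : countable A -> (@lebesgue_measure R).-negligible A.
  move=> cA; apply/negligibleP; last exact: countable_lebesgue_measure0.
  by apply: countable_measurable => // t; exact: measurable_set1.
(* The concave corners of [f] are the convex corners of [- f]. *)
have := negligibleU (cneg _ (countable_left_derivative_lt_right f))
  (cneg _ (countable_left_derivative_lt_right (fun t => - f t))).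
apply: negligibleS.
move=> t [l1 [l2 [c1 c2]]].
rewrite neq_lt => /orP[l12|l12]; [right|by left; exists l1, l2].
exists (- l1), (- l2); split; last lra.
  under eq_fun do rewrite -opprD mulNr; exact: cvgN.
by under eq_fun do rewrite -opprD mulNr; exact: cvgN.
Qed.

(** * Absolute continuity and null sets *)

(** Intervals will be collected in a list by concatenation; this gives the disjointness that
    [absolutely_continuous_on] asks for. *)
Lemma pairwise_trivIset_itvoo (R : realType) (s : seq (R * R)) :
  pairwise (fun p q => p.2 <= q.1) s ->
  trivIset [set: 'I_(size s)]
    (fun i => `](nth 0 s i).1, (nth 0 s i).2[%classic).
Proof.
move=> /(pairwiseP 0) ps.
have lt_disj (i j : 'I_(size s)) x : (i < j)%N ->
    x \in `](nth 0 s i).1, (nth 0 s i).2[ ->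
    x \in `](nth 0 s j).1, (nth 0 s j).2[ -> False.
  move=> ij; rewrite !in_itv/= => /andP[_ xi] /andP[xj _].
  have := ps i j; rewrite !inE !ltn_ord => /(_ isT isT ij) ij'.
  by have := lt_trans xi (le_lt_trans ij' xj); rewrite ltxx.
move=> i j _ _ [x [xi xj]]; apply/val_inj/eqP.
by case: ltngtP => // ij; exfalso; [apply: lt_disj xi xj|apply: lt_disj xj xi].
Qed.

(** The lengths add up to the measure of the disjoint union, which lies in [G]. *)
Lemma sum_itvoo_le (R : realType) (G : set R) (m : nat) (s t : 'I_m -> R)
    (e : R) :
  measurable G -> (lebesgue_measure G < e%:E)%E ->
  (forall i, s i <= t i) ->
  (forall i, `]s i, t i[%classic `<=` G) ->
  trivIset [set: 'I_m] (fun i => `]s i, t i[%classic) ->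
  \sum_(i < m) (t i - s i) < e.
Proof.
move=> mG Ge st sG tr; rewrite -lte_fin; apply: le_lt_trans Ge.
pose I i : set R := `]s i, t i[%classic.
have mI i : measurable (I i) by exact: measurable_itv.
have -> : ((\sum_(i < m) (t i - s i))%:E =
    \sum_(i < m) (@lebesgue_measure R) (I i))%E.
  rewrite -sumEFin; apply: eq_bigr => i _.
  rewrite /I lebesgue_measure_itv/= lte_fin; case: ltP => // ts.
  by rewrite (@le_anti _ _ (s i) (t i)) ?subrr// st ts.
rewrite -measure_bigsetU_ord//; apply: le_measure; rewrite ?inE//.
  exact: (bigsetU_measurable (index_enum _) (fun i _ => mI i)).
apply: (big_ind (fun X => X `<=` G)) => [x []|X Y XG YG x [/XG|/YG]|i _] //.
exact: sG.
Qed.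

(** [Z] itself may fail to be measurable, so outer regularity is applied to a measurable null set
    containing it. *)
Lemma negligible_open_cover (R : realType) (Z : set R) (e : R) :
  (@lebesgue_measure R).-negligible Z -> 0 < e ->
  exists G : set R, [/\ open G, Z `<=` G & (lebesgue_measure G < e%:E)%E].
Proof.
move=> [A [mA A0 ZA]] e0.
have {}A0 : lebesgue_measure A = 0 := A0.
have [|G [oG AG Ge]] := lebesgue_regularity_outer mA _ e0.
  by rewrite [X in (X < _)%E]A0.
exists G; split=> //; first exact: subset_trans AG.
have mG : measurable G by exact: measurable_realfun.open_measurable.
rewrite -(setDUK AG); apply: le_lt_trans (measureU2 _ _ _) _ => //.
  exact: measurableD.
by rewrite [X in (X + _)%E]A0 add0e.
Qed.


(* The null set Z is covered by an open set of small measure, on which the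
   increments of phi sum up to little by absolute continuity; off Z the local
   bounds are chained. *)
Lemma null_set_increment_le (R : realType) (n : nat) (phi : R -> 'rV[R]_n)
    (a b d L : R) (D : R -> R -> R) (Z : set R) :
  a <= b -> 0 <= L -> absolutely_continuous_on a b phi ->
  (@lebesgue_measure R).-negligible Z ->
  (forall u v w, a <= u -> u <= v -> v <= w -> w <= b ->
    D u w <= D u v + D v w) ->
  (forall u v, a <= u -> u <= v -> v <= b ->
    D u v <= L * `|phi v - phi u|) ->
  (forall t e, a <= t <= b -> ~ Z t -> 0 < e -> exists2 r : R, 0 < r &
    forall h, 0 <= h < r -> (t + h <= b -> D t (t + h) <= (d + e) * h) /\
                            (a <= t - h -> D (t - h) t <= (d + e) * h)) ->
  D a b <= d * (b - a).
Proof.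
move=> leab L0 ac Z0 Dsub DL Dloc; apply/ler_addgt0Pr => e e0.
have ba1 : 0 < b - a + 1 by lra.
(* The error [e] is split in three: the slack in the slope, the variation of [phi] over the cover of
   [Z], and the length of that cover. The [+ 1] in the denominators avoids division by zero. *)
pose e1 := e / 3 / (b - a + 1).
have e10 : 0 < e1 by rewrite !divr_gt0.
have e1b : e1 * (b - a) <= e / 3.
  rewrite /e1 mulrAC ler_pdivrMr// ler_pM2l ?divr_gt0//; lra.
have L10 : 0 < L + 1 by lra.
have [|eta eta0 Heta] := ac (e / 3 / (L + 1)); first by rewrite !divr_gt0.
pose K := `|d + e1|.
have K0 : 0 <= K by exact: normr_ge0.
have K10 : 0 < K + 1 by rewrite ltr_wpDl.
pose eta' := Num.min eta (e / 3 / (K + 1)).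
have eta'0 : 0 < eta' by rewrite lt_min eta0 !divr_gt0.
have [G [oG ZG Gle]] := negligible_open_cover Z0 eta'0.
(* On an interval of the cover, the term in [K] offsets [(d + e1) * (v - u)], which may be
   negative. *)
pose inc (p : R * R) := L * `|phi p.2 - phi p.1| + K * (p.2 - p.1).
(* The list [s] holds the intervals inside [G] that are charged by [inc]; concatenation of lists
   makes [P] additive. *)
pose P u v := exists s : seq (R * R), [/\
  forall p, p \in s -> [/\ u <= p.1, p.1 <= p.2, p.2 <= v &
                         `]p.1, p.2[%classic `<=` G],
  pairwise (fun p q => p.2 <= q.1) s &
  D u v <= (d + e1) * (v - u) + \sum_(p <- s) inc p].
have [s [sG ps Ds]] : P a b.
  apply: additive_segment => // [u v w au uv vw wb|t tab].
    move=> [s1 [G1 p1 D1]] [s2 [G2 p2 D2]]; exists (s1 ++ s2); split.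
    - move=> p; rewrite mem_cat.
      move=> /orP[/G1[? ? pv ?]|/G2[vp ? ? ?]]; split=> //.
        exact: le_trans vw.
      exact: le_trans vp.
    - rewrite pairwise_cat p1 p2 !andbT; apply/allrelP => p q /G1[_ _ pv _].
      by move=> /G2[vq _ _ _]; exact: le_trans vq.
    - by rewrite big_cat/=; have := Dsub u v w au uv vw wb; lra.
  have [Zt|Zt] := pselect (Z t); last first.
    have [r r0 rD] := Dloc t e1 tab Zt e10; exists r => // u v au ut tv vb vur.
    exists [::]; split => //; rewrite big_nil addr0.
    have [|+ _] := rD (v - t); first lra.
    have [|_ +] := rD (t - u); first lra.
    rewrite (_ : t - (t - u) = u); last ring.
    rewrite (_ : t + (v - t) = v); last ring.
    move=> /(_ au) Du /(_ vb) Dv.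
    by have := Dsub u t v au ut tv vb; lra.
  have /nbhs_ballP[r /= r0 rG] : nbhs t G
    by apply: open_nbhs_nbhs; split => //; exact: ZG.
  exists r => // u v au ut tv vb vur.
  have uv := le_trans ut tv.
  exists [:: (u, v)]; split => //.
    move=> p; rewrite inE => /eqP -> /=; split => // x /=.
    rewrite in_itv/= => /andP[ux xv]; apply: rG.
    by rewrite /ball/= ltr_distl; lra.
  rewrite big_seq1 /inc/=; have := DL _ _ au uv vb.
  have : 0 <= (d + e1 + K) * (v - u).
    rewrite mulr_ge0 ?subr_ge0// /K.
    by have := ler_norm (- (d + e1)); rewrite normrN; lra.
  lra.
pose s1 (i : 'I_(size s)) := (nth 0 s i).1.
pose s2 (i : 'I_(size s)) := (nth 0 s i).2.
have s12 i : [/\ a <= s1 i, s1 i <= s2 i, s2 i <= b &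
    `]s1 i, s2 i[%classic `<=` G] by apply: sG; exact: mem_nth.
have tr := pairwise_trivIset_itvoo ps.
have len : \sum_(i < size s) (s2 i - s1 i) < eta'.
  apply: (sum_itvoo_le _ Gle _ _ tr) => [|i|i]; [|by case: (s12 i)..].
  exact: measurable_realfun.open_measurable.
have leneta : \sum_(i < size s) (s2 i - s1 i) < eta.
  by apply: lt_le_trans len _; rewrite ge_min lexx.
have lenK : \sum_(i < size s) (s2 i - s1 i) < e / 3 / (K + 1).
  by apply: lt_le_trans len _; rewrite ge_min lexx orbT.
have := Heta _ s1 s2 _ tr leneta.
move=> /(_ _)/wrap[i|]; first by case: (s12 i).
move: Ds; rewrite (big_nth 0) big_mkord /inc big_split/= -!mulr_sumr.
rewrite -/s1 -/s2.
set S1 := \sum_(i < size s) `|_|.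
set S2 := \sum_(i < size s) (_ - _) in lenK *.
move: lenK; rewrite !ltr_pdivlMr// => lenK DS HS.
have : 0 <= S1 by apply: sumr_ge0.
have : 0 <= S2 by apply: sumr_ge0 => i _; rewrite subr_ge0; case: (s12 i).
move: K0.
lra.
Qed.

(** * Clarke gradient and Lie derivative *)

Lemma dotpN (R : realType) (n : nat) (u v : 'rV[R]_n) :
  dotp u (- v) = - dotp u v.
Proof. by rewrite /dotp -sumrN; apply: eq_bigr => i _; rewrite mxE mulrN. Qed.

Lemma cvg_dotp (R : realType) (n : nat) (T : Type) (G : set_system T)
    (f : T -> 'rV[R]_n) (z v : 'rV[R]_n) : Filter G ->
  f @ G --> z -> dotp (f x) v @[x --> G] --> dotp z v.
Proof.
move=> FG fz; rewrite /dotp; elim: (index_enum _) => [|i r IHr].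
  by under eq_fun do rewrite big_nil; rewrite big_nil; exact: cvg_cst.
under eq_fun do rewrite big_cons; rewrite big_cons; apply: cvgD => //.
apply: cvgMl.
apply: (@continuous_cvg _ _ _ _ _ _ (fun M : 'rV[R]_n => M 0 i)) => //.
exact: coord_continuous.
Qed.

Lemma derive_dotp_gradient (R : realType) (n : nat) (W : 'rV[R]_n -> R)
    (x v : 'rV[R]_n) : differentiable W x -> 'D_v W x = dotp (gradient W x) v.
Proof.
move=> dW; rewrite deriveE// [in LHS](row_sum_delta v) linear_sum/= /dotp.
apply: eq_bigr => i _.
by rewrite linearZ/= mxE deriveE// mulrC.
Qed.

(** The limsup is an infimum over the sets of the filter, so some set has its supremum within [e] of
    it. *)
Lemma clarke_derivative_near (R : realType) (n : nat) (W : 'rV[R]_n -> R)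
    (x v : 'rV[R]_n) (l e : R) : clarke_derivative W x v = l%:E -> 0 < e ->
  \forall p \near filter_prod (nbhs x) (0 : R)^'+,
    (W (p.1 + p.2 *: v) - W p.1) / p.2 <= l + e.
Proof.
rewrite /clarke_derivative /limf_esup => Wl e0.
set X := (X in ereal_inf X) in Wl.
have [|y [V FV <-]] := @lb_ereal_inf_adherent _ X e e0; first by rewrite Wl.
rewrite Wl => /ltW Vle; apply: filterS FV => p Vp.
rewrite -lee_fin; apply: le_trans Vle.
by apply: ereal_sup_ubound; exists p.
Qed.

(** A half-space is convex, so only the generators of the hull matter: limits of gradients, whose
    products with [v] are limits of directional derivatives at points near [x]. *)
Lemma clarke_gradient_dotp_le (R : realType) (n : nat) (N : set 'rV[R]_n)
    (W : 'rV[R]_n -> R) (x v z : 'rV[R]_n) (l : R) :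
  clarke_derivative W x v = l%:E -> clarke_gradient N W x z -> dotp z v <= l.
Proof.
move=> Wl; pose B : set 'rV[R]_n := [set z | dotp z v <= l].
apply: (@smallest_sub _ _ _ B).
  move=> y1 y2 t; rewrite !inE /B/= => y1l y2l.
  rewrite (_ : dotp _ v = t%:num * dotp y1 v + (1 - t%:num) * dotp y2 v).
    have t0 : 0 <= t%:num by [].
    have t1 : t%:num <= 1 by [].
    have := ler_wpM2l t0 y1l.
    by have := @ler_wpM2l _ (1 - t%:num) _ _ _ y2l; lra.
  rewrite /dotp !mulr_sumr -big_split/=; apply: eq_bigr => i _.
  by rewrite !mxE mulrDl !mulrA.
move=> {}z [u [ux ud uz]].
apply/ler_addgt0Pr => e e0.
(* The quotient bound is uniform for base points in [P] and steps in [Q], so [h] can tend to 0 with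
   [u k] fixed. *)
have [[P Q] [/= xP Q0] PQ] := clarke_derivative_near Wl e0.
apply: (ler_cvg_to (@cvg_dotp _ _ _ _ _ _ v _ uz) (cvg_cst (l + e))).
have : \forall k \near \oo, P (u k) by exact: ux xP.
apply: filterS => k Pk; have [_ duk] := ud k.
rewrite -derive_dotp_gradient//.
have : (W (u k + h *: v) - W (u k)) / h @[h --> (0 : R)^'+] --> 'D_v W (u k).
  have := @diff_derivable _ _ _ _ _ v duk => /cvg_ex[y Wy].
  rewrite /derive (cvg_lim _ Wy)//.
  apply: cvg_dnbhs_at_right; apply: cvg_trans Wy; apply: near_eq_cvg.
  by near=> h; rewrite /= [h *: v + _]addrC [RHS]mulrC.
move=> dk; apply: (ler_cvg_to dk (cvg_cst (l + e))).
by apply: filterS Q0 => h Qh; exact: (PQ (u k, h)).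
Unshelve. all: by end_near.
Qed.

Lemma lie_derivative_regular (R : realType) (n : nat) (N : set 'rV[R]_n)
    (F : 'rV[R]_n -> set 'rV[R]_n) (W : 'rV[R]_n -> R) (x v : 'rV[R]_n)
    (l1 l2 : R) : F x v ->
  clarke_derivative W x v = l1%:E -> clarke_derivative W x (- v) = l2%:E ->
  l1 + l2 = 0 -> lie_derivative N F W x l1.
Proof.
move=> Fv W1 W2 l12; exists v => // z zW; apply/le_anti/andP; split.
  exact: clarke_gradient_dotp_le zW.
have := clarke_gradient_dotp_le W2 zW; rewrite dotpN; lra.
Qed.

(** * Lipschitz functions along curves *)

Lemma locally_lipschitzP (R : realType) (n : nat) (O : set 'rV[R]_n)
    (W : 'rV[R]_n -> R) (x : 'rV[R]_n) : locally_lipschitz_on O W -> O x ->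
  exists L : R, 0 <= L /\ exists2 U, nbhs x U &
    forall y z, U y -> U z -> `|W y - W z| <= L * `|y - z|.
Proof.
move=> lW /lW[U xU [M [_ HM]]].
exists (`|M| + 1); split; first by rewrite addr_ge0.
exists U => // y z Uy Uz.
by have /= := HM (`|M| + 1) _ (y, z); apply => //; have := ler_norm M; lra.
Qed.

(** To first order [c h] agrees with [x + h *: v], and the Lipschitz bound makes the resulting error
    in [W] negligible against [h]. A general [c] covers motion both forward and backward in time. *)
Lemma one_sided_derivative_along (R : realType) (n : nat) (W : 'rV[R]_n -> R)
    (c : R -> 'rV[R]_n) (x v : 'rV[R]_n) (l L : R) (U : set 'rV[R]_n) :
  nbhs x U -> (forall y z, U y -> U z -> `|W y - W z| <= L * `|y - z|) ->
  h^-1 *: (c h - x) @[h --> (0 : R)^'+] --> v ->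
  (W (x + h *: v) - W x) / h @[h --> (0 : R)^'+] --> l ->
  (W (c h) - W x) / h @[h --> (0 : R)^'+] --> l.
Proof.
move=> xU WL cv Wl.
have id0 : h @[h --> (0 : R)^'+] --> (0 : R).
  by apply: cvg_at_right_filter; exact: cvg_id.
have hneq : \forall h \near (0 : R)^'+, h != 0.
  by near=> h; rewrite gt_eqF//; near: h; exact: nbhs_right_gt.
(* The Lipschitz bound applies only inside [U]; that [c h] ends up there follows from the limit of
   the quotient. *)
have cx : c h @[h --> (0 : R)^'+] --> x.
  have : x + h *: (h^-1 *: (c h - x)) @[h --> (0 : R)^'+] --> x + 0 *: v.
    by apply: cvgD; [exact: cvg_cst|exact: cvgZ].
  rewrite scale0r addr0; apply: cvg_trans; apply: near_eq_cvg.
  by apply: filterS hneq => h h0; rewrite scalerA divff// scale1r addrC subrK.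
have xv : x + h *: v @[h --> (0 : R)^'+] --> x.
  rewrite -[X in _ --> X]addr0 -(scale0r v).
  by apply: cvgD; [exact: cvg_cst|apply: cvgZ => //; exact: cvg_cst].
suff diff : (W (c h) - W (x + h *: v)) / h @[h --> (0 : R)^'+] --> (0 : R).
  rewrite -[X in _ --> X](addr0 l).
  apply: (cvg_trans _ (cvgD Wl diff)); apply: near_eq_cvg; near=> h.
  by rewrite /= -mulrDl addrC addrA subrK.
apply: norm_cvg0.
have : L * `|h^-1 *: (c h - x) - v| @[h --> (0 : R)^'+] --> L * `|v - v|.
  by apply: cvgMr; apply: cvg_norm; apply: cvgB => //; exact: cvg_cst.
rewrite subrr normr0 mulr0 => Lc.
apply: (squeeze_cvgr _ (cvg_cst 0) Lc).
have [Uc Uv] := (cx _ xU, xv _ xU).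
near=> h.
rewrite normr_ge0/=.
have h0 : 0 < h by near: h; exact: nbhs_right_gt.
rewrite normrM normfV (gtr0_norm h0) ler_pdivrMr//.
apply: (le_trans (WL _ _ _ _)); [by near: h; exact: Uc|by near: h; exact: Uv|].
rewrite -mulrA -[X in _ * (_ * X)](gtr0_norm h0) -(mulrC `|h|) -normrZ.
rewrite scalerBr scalerA divff ?gt_eqF// scale1r opprD addrA.
by rewrite lexx.
Unshelve. all: by end_near.
Qed.

(** Backward motion is read as a curve leaving with velocity [- derive1 phi t], so both limits are
    taken at [0^'+]. *)
Lemma derivable_one_sided (R : realType) (n : nat) (phi : R -> 'rV[R]_n)
    (t : R) : derivable phi t 1 ->
  h^-1 *: (phi (t + h) - phi t) @[h --> (0 : R)^'+] --> derive1 phi t /\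
  h^-1 *: (phi (t - h) - phi t) @[h --> (0 : R)^'+] --> - derive1 phi t.
Proof.
move=> dphi.
have dl : h^-1 *: (phi (h + t) - phi t) @[h --> (0 : R)^'] --> derive1 phi t.
  move: dphi; rewrite /derivable.
  rewrite (_ : (fun h : R => _) =
    fun h => h^-1 *: (phi (h + t) - phi t)) => [//|].
  by apply/funext => h /=; rewrite [h *: 1]mulr1.
have ld : - h @[h --> (0 : R)^'+] `=>` (0 : R)^'.
  rewrite -at_leftN oppr0; apply: within_subset => h /= h0.
  by rewrite lt_eqF.
split.
  by under eq_fun do rewrite (addrC t); exact: cvg_dnbhs_at_right.
apply: (cvg_trans _ (cvg_comp _ _ ld (cvgN dl))); apply: near_eq_cvg.
by near=> h; rewrite /= opprfctE invrN scaleNr opprK (addrC (- h)).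
Unshelve. all: by end_near.
Qed.

(** * Increment estimates along a solution *)

Lemma absolutely_continuous_onW (R : realType) (n : nat) (a b a' b' : R)
    (phi : R -> 'rV[R]_n) : a <= a' -> b' <= b ->
  absolutely_continuous_on a b phi -> absolutely_continuous_on a' b' phi.
Proof.
move=> aa bb ac e e0; have [d d0 Hd] := ac e e0; exists d => // m s t st.
apply: Hd => i; have [? [? ?]] := st i; split; first exact: le_trans aa _.
by split => //; exact: le_trans bb.
Qed.

Lemma absolutely_continuous_on_near (R : realType) (n : nat) (a b t : R)
    (phi : R -> 'rV[R]_n) : absolutely_continuous_on a b phi -> a < t < b ->
  {for t, continuous phi}.
Proof.
move=> ac /andP[at_ tb]; apply/cvgrPdist_lt => e e0.
have [d d0 Hd] := ac e e0.
pose r := Num.min d (Num.min (t - a) (b - t)).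
have r0 : 0 < r by rewrite !lt_min d0 !subr_gt0 at_ tb.
near=> s.
have : `|t - s| < r by near: s; exact: (@cvgr_dist_lt _ _ _ _ _ id t).
rewrite !lt_min !ltr_distl => /and3P[ts1 ts2 ts3].
have mono u v : a <= u -> u <= v -> v <= b -> v - u < d -> `|phi v - phi u| < e.
  move=> au uv vb vud.
  have := Hd 1%N (fun=> u) (fun=> v); rewrite !big_ord1; apply => //.
  by move=> i j _ _ _; rewrite !ord1.
have [st|st] := leP s t; first by apply: mono => //; lra.
by rewrite distrC; apply: mono; lra.
Unshelve. all: by end_near.
Qed.

(** Time 0 is excluded because the continuity is two-sided and [phi] is arbitrary at negative
    times. *)
Lemma solution_continuous (R : realType) (n : nat)
    (F : 'rV[R]_n -> set 'rV[R]_n) (phi : R -> 'rV[R]_n) (t : R) :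
  is_solution F phi -> 0 < t -> {for t, continuous phi}.
Proof.
move=> [ac _] t0.
by apply: (absolutely_continuous_on_near (ac (t + 1) _)); lra.
Qed.

Lemma solution_absolutely_continuous (R : realType) (n : nat)
    (F : 'rV[R]_n -> set 'rV[R]_n) (phi : R -> 'rV[R]_n) (a b : R) :
  is_solution F phi -> 0 <= a ->
  absolutely_continuous_on a b phi.
Proof.
move=> [ac _] a0.
have [b0|b0] := ltP 0 b; first exact: absolutely_continuous_onW (ac b b0).
apply: (absolutely_continuous_onW _ _ (ac 1 ltr01)) => //.
exact: le_trans b0 ler01.
Qed.

Lemma solution_ae (R : realType) (n : nat)
    (F : 'rV[R]_n -> set 'rV[R]_n) (phi : R -> 'rV[R]_n) :
  is_solution F phi -> exists2 Z, (@lebesgue_measure R).-negligible Z &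
  forall t, 0 <= t -> ~ Z t -> derivable phi t 1 /\ F (phi t) (derive1 phi t).
Proof.
move=> [_ ae].
exists (~` [set t | 0 <= t -> derivable phi t 1 /\ F (phi t) (derive1 phi t)]).
  exact: ae.
by move=> t t0 /contrapT; apply.
Qed.

(** This is [null_set_increment_le] for the norm of the increment: off a null set the velocity
    exists and lies in [F (phi t)]. *)
Lemma solution_speed_le (R : realType) (n : nat)
    (F : 'rV[R]_n -> set 'rV[R]_n) (phi : R -> 'rV[R]_n) (a b K : R) :
  is_solution F phi -> 0 <= a -> a <= b ->
  (forall t v, a <= t <= b -> F (phi t) v -> `|v| <= K) ->
  `|phi b - phi a| <= K * (b - a).
Proof.
move=> sol a0 ab FK; have [Z Z0 HZ] := solution_ae sol.
apply: (@null_set_increment_le _ _ phi a b K 1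
  (fun u v => `|phi v - phi u|) Z) => //.
- exact: solution_absolutely_continuous sol _.
- by move=> u v w * /=; rewrite [leRHS]addrC ler_distD.
- by move=> u v * /=; rewrite mul1r.
move=> t e tab Zt e0.
have [|dt Ft] := HZ t _ Zt; first by lra.
have vK := FK _ _ tab Ft.
have [cr cl] := derivable_one_sided dt.
have bound (c : R -> 'rV[R]_n) (v : 'rV[R]_n) : `|v| <= K ->
    h^-1 *: (c h - phi t) @[h --> (0 : R)^'+] --> v ->
    \forall h \near (0 : R)^'+, `|c h - phi t| <= (K + e) * h.
  move=> {}vK cv.
  have : \forall h \near (0 : R)^'+, `|h^-1 *: (c h - phi t)| <= K + e.
    by apply: cvgr_norm_le cv _ _; rewrite ltr_pwDr.
  move=> H; near=> h.
  have h0 : 0 < h by near: h; exact: nbhs_right_gt.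
  have : `|h^-1 *: (c h - phi t)| <= K + e by near: h; exact: H.
  by rewrite normrZ normfV gtr0_norm// mulrC ler_pdivrMr.
have br := bound _ _ vK cr.
have bl := bound _ _ _ cl; rewrite normrN in bl; have {}bl := bl vK.
have /nbhs_ballP[r /= r0 rb] : \forall h \near (0 : R)^'+,
    `|phi (t + h) - phi t| <= (K + e) * h /\
    `|phi (t - h) - phi t| <= (K + e) * h by exact: filterI.
exists r => // h /andP[h0 hr].
(* The filter [0^'+] says nothing about [h = 0], which is treated apart. *)
have [h0'|h0'] := leP h 0.
  have -> : h = 0 by apply/le_anti/andP.
  by rewrite addr0 subr0 subrr normr0 mulr0.
have [|//|b1 b2] := rb h.
  by rewrite /ball/= sub0r normrN gtr0_norm.
by split => // _; rewrite distrC.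
Unshelve. all: by end_near.
Qed.

Lemma solution_increment_le (R : realType) (n : nat)
    (F : 'rV[R]_n -> set 'rV[R]_n) (phi : R -> 'rV[R]_n)
    (O N : set 'rV[R]_n) (W : 'rV[R]_n -> R) (a b d : R) :
  is_solution F phi -> 0 < a -> a <= b ->
  locally_lipschitz_on O W -> (forall x, O x -> regular_at W x) ->
  (forall t, a <= t <= b -> O (phi t)) ->
  (forall t c, a <= t <= b -> lie_derivative N F W (phi t) c -> c <= d) ->
  W (phi b) - W (phi a) <= d * (b - a).
Proof.
move=> sol a0 ab lipW regW Ophi lie_le; have [Z Z0 HZ] := solution_ae sol.
pose g := W \o phi.
(* [null_set_increment_le] needs one Lipschitz constant for [W], available only locally, so the
   interval is cut into short pieces. *)
apply: (@additive_segment _ (fun u v => g v - g u <= d * (v - u))) => //.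
  by move=> u v w *; lra.
move=> t0 t0ab.
have [L [L0 [U tU WL]]] := locally_lipschitzP lipW (Ophi _ t0ab).
have cphi : phi t @[t --> t0] --> phi t0.
  by apply: (solution_continuous sol); lra.
have /nbhs_ballP[r /= r0 rU] := cphi _ tU.
exists r => // u v au ut tv vb uvr.
have phiU s : u <= s <= v -> U (phi s).
  by move=> usv; apply: rU; rewrite /ball/= ltr_distl; lra.
(* The exceptional set also contains the corners of [g]; elsewhere [l1 + l2 = 0], and [l1] belongs
   to the Lie derivative. *)
apply: (@null_set_increment_le _ _ phi u v d L (fun u v => g v - g u)
  (Z `|` [set t | exists l1 l2 : R, [/\
    (g (t + h) - g t) / h @[h --> (0 : R)^'+] --> l1,
    (g (t - h) - g t) / h @[h --> (0 : R)^'+] --> l2 & l1 + l2 != 0]])).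
- exact: le_trans tv.
- by [].
- by apply: (solution_absolutely_continuous _ sol); lra.
- by apply: negligibleU => //; exact: negligible_one_sided_derivatives_neq.
- by move=> *; lra.
- move=> p q up pq qv; apply: le_trans (ler_norm _) _.
  by apply: WL; apply: phiU; lra.
move=> t e tuv /not_orP[Zt corner] e0.
have tab : a <= t <= b by lra.
have [|dt Ft] := HZ t _ Zt; first by lra.
have Ot := Ophi _ tab.
have [M [M0 [V xV WM]]] := locally_lipschitzP lipW Ot.
have [cr cl] := derivable_one_sided dt.
have [l1 Wl1 Cl1] := regW _ Ot (derive1 phi t).
have [l2 Wl2 Cl2] := regW _ Ot (- derive1 phi t).
have gr : (g (t + h) - g t) / h @[h --> (0 : R)^'+] --> l1.
  exact: (one_sided_derivative_along xV WM cr Wl1).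
have gl : (g (t - h) - g t) / h @[h --> (0 : R)^'+] --> l2.
  exact: (one_sided_derivative_along xV WM cl Wl2).
have l12 : l1 + l2 = 0.
  by apply/eqP; apply: contra_notT corner => l12; exists l1, l2.
have l1d : l1 <= d.
  apply: (lie_le _ _ tab).
  exact: (lie_derivative_regular N Ft Cl1 Cl2 l12).
have br : \forall h \near (0 : R)^'+, (g (t + h) - g t) / h <= l1 + e.
  by apply: cvgr_le gr _ _; rewrite ltrDl.
(* Since [l2 = - l1], this lower bound is an upper bound on the increment of [g] from [t - h] to
   [t]. *)
have bl : \forall h \near (0 : R)^'+, l2 - e <= (g (t - h) - g t) / h.
  by apply: cvgr_ge gl _ _; rewrite gtrBl.
have /nbhs_ballP[s /= s0 sb] : \forall h \near (0 : R)^'+,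
    (g (t + h) - g t) / h <= l1 + e /\ l2 - e <= (g (t - h) - g t) / h.
  exact: filterI.
exists s => // h /andP[h0 hs].
have [h0'|h0'] := leP h 0.
  have -> : h = 0 by apply/le_anti/andP.
  by rewrite addr0 subr0 subrr mulr0.
have [|//|] := sb h.
  by rewrite /ball/= sub0r normrN gtr0_norm.
rewrite ler_pdivrMr// ler_pdivlMr// => b1 b2.
have le1 : (l1 + e) * h <= (d + e) * h by rewrite ler_wpM2r// lerD2r.
have : l2 * h = - l1 * h by congr (_ * _); lra.
by split => // _; lra.
Qed.

(** * Local properties of [W] and [F] *)

Lemma locally_lipschitz_continuous (R : realType) (n : nat)
    (O : set 'rV[R]_n) (W : 'rV[R]_n -> R) (x : 'rV[R]_n) :
  locally_lipschitz_on O W -> O x -> {for x, continuous W}.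
Proof.
move=> lW Ox; have [L [L0 [U xU WL]]] := locally_lipschitzP lW Ox.
apply/(@cvgrPdist_le _ _ _ _ (nbhs_filter x)) => e e0.
have e10 : 0 < e / (L + 1) by rewrite divr_gt0// ltr_wpDl.
have xe : \forall y \near x, ball x (e / (L + 1)) y by exact: nbhsx_ballx.
apply: (@filterS2 _ _ _ _ _ _ _ xU xe) => y Uy xy.
apply: (le_trans (WL _ _ (nbhs_singleton xU) Uy)).
have : `|x - y| < e / (L + 1) by move: xy; rewrite -ball_normE.
rewrite ltr_pdivlMr ?ltr_wpDl//.
have := normr_ge0 (x - y); lra.
Qed.

(** Semicontinuity with [eps = 1] keeps nearby values within distance 1 of the bounded set [F x]. *)
Lemma usc_locally_bounded (R : realType) (n : nat)
    (F : 'rV[R]_n -> set 'rV[R]_n) (x : 'rV[R]_n) :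
  upper_semicontinuous F x -> compact (F x) ->
  exists2 K : R, 0 < K & exists2 r : R, 0 < r &
    forall y v, ball x r y -> F y v -> `|v| <= K.
Proof.
move=> uscF /compact_bounded[M [_ HM]].
have [r r0 Hr] := uscF 1 ltr01.
exists (`|M| + 1 + 1); first by rewrite ltr_wpDl// addr_ge0.
exists r => // y v xy Fv; have [u Fu [w w1 <-]] := Hr _ xy _ Fv.
apply: le_trans (ler_normD _ _) _; apply: lerD.
  by apply: (HM (`|M| + 1)) => //; have := ler_norm M; lra.
by apply/ltW; move: w1; rewrite -ball_normE /ball_/= sub0r normrN.
Qed.

(** * Omega-limit sets *)

(** This form without sequences makes closedness immediate. A sequence is recovered by choosing
    [t k >= k] with [phi (t k)] at distance below [1 / (k + 1)] from [y]. *)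
Lemma omega_limitP (R : realType) (n : nat) (phi : R -> 'rV[R]_n)
    (y : 'rV[R]_n) : omega_limit phi y <->
  forall T A, nbhs y A -> exists2 t, T <= t & 0 <= t /\ A (phi t).
Proof.
split=> [[t [t0 toy ty]] T A yA|H].
  have : \forall k \near \oo, T <= t k /\ A (phi (t k)).
    apply: filterI; last exact: (ty _ yA).
    exact: (toy _ (nbhs_pinfty_ge (num_real T))).
  by move=> /filter_ex[k [Tk Ak]]; exists (t k).
have H' (k : nat) : exists t, [/\ k%:R <= t, 0 <= t &
    `|y - phi t| < k.+1%:R^-1].
  have [|t kt [t0 yt]] := H k%:R (ball y k.+1%:R^-1).
    by apply: nbhsx_ballx; rewrite invr_gt0.
  by exists t; split => //; move: yt; rewrite -ball_normE.
have [t Ht] := choice H'; exists t; split.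
- by move=> k; case: (Ht k).
- apply/cvgryPge => M; near=> k.
  have [kt _ _] := Ht k; apply: le_trans kt.
  by near: k; exact: nbhs_infty_ger.
apply/cvgrPdist_lt => e e0; near=> k.
have [_ _ yt] := Ht k; apply: (lt_trans yt).
by near: k; exact: near_infty_natSinv_lt (PosNum e0).
Unshelve. all: by end_near.
Qed.

Lemma closed_omega_limit (R : realType) (n : nat) (phi : R -> 'rV[R]_n) :
  closed (omega_limit phi).
Proof.
move=> y yO; apply/omega_limitP => T A yA.
have [z [/omega_limitP zO zA]] := yO _ (nbhs_interior yA).
exact: zO.
Qed.

Lemma compact_norm_le (R : realType) (n : nat) (M : R) :
  compact [set x : 'rV[R]_n | `|x| <= M].
Proof.
apply: bounded_closed_compact.
  exists M; split; first exact: num_real.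
  by move=> N MN x /= xM; exact: le_trans (ltW MN).
apply: (@closed_comp _ _ (fun x : 'rV[R]_n => `|x|) [set r | r <= M]).
  by move=> x _; exact: norm_continuous.
exact: closed_le.
Qed.

Lemma bounded_solution_norm_le (R : realType) (n : nat)
    (phi : R -> 'rV[R]_n) : bounded_set (phi @` [set t | 0 <= t]) ->
  exists M : R, forall t, 0 <= t -> `|phi t| <= M.
Proof.
move=> [M [_ HM]]; exists (M + 1) => t t0.
by apply: (HM (M + 1)); [rewrite ltrDl|exists t].
Qed.

Lemma compact_omega_limit (R : realType) (n : nat) (phi : R -> 'rV[R]_n) :
  bounded_set (phi @` [set t | 0 <= t]) -> compact (omega_limit phi).
Proof.
move=> /bounded_solution_norm_le[M HM].
apply: (subclosed_compact _ (@compact_norm_le _ _ (M + 1))).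
  exact: closed_omega_limit.
move=> y /omega_limitP /(_ 0 (ball y 1))[|t _ [t0]].
  exact: nbhsx_ballx.
rewrite -ball_normE /ball_/= => yt.
have := ler_normD (y - phi t) (phi t); rewrite subrK => /le_trans; apply.
by rewrite addrC lerD ?HM// ltW.
Qed.

(** Otherwise [phi] is outside [G] at times [t k >= k]; by compactness these values cluster at an
    omega-limit point, of which [G] is a neighborhood. *)
Lemma omega_limit_attracts (R : realType) (n : nat) (phi : R -> 'rV[R]_n)
    (G : set 'rV[R]_n) :
  bounded_set (phi @` [set t | 0 <= t]) ->
  (forall y, omega_limit phi y -> nbhs y G) ->
  exists T : R, forall t, T <= t -> G (phi t).
Proof.
move=> /bounded_solution_norm_le[M HM] OG.
apply: contrapT => nG.
have H (k : nat) : exists t, k%:R <= t /\ ~ G (phi t).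
  apply: contrapT => Hk; apply: nG; exists k%:R => t kt.
  by apply: contrapT => Gt; apply: Hk; exists t.
have [t Ht] := choice H.
have tM : \forall k \near \oo, `|phi (t k)| <= M.
  by near=> k; apply: HM; have [kt _] := Ht k; exact: le_trans kt.
have [p [_ pcl]] := @compact_norm_le R n M (phi \o t @ \oo) _ tM.
have pO : omega_limit phi p.
  apply/omega_limitP => T A pA.
  have tT : \forall k \near \oo,
      ((phi \o t) @` [set k | T <= k%:R]) (phi (t k)).
    by near=> k; exists k => //=; near: k; exact: nbhs_infty_ger.
  have [_ [[k Tk <-] Ak]] := pcl _ A tT pA.
  have [kt _] := Ht k; exists (t k); first exact: le_trans kt.
  by split => //; exact: le_trans kt.
have tG : \forall k \near \oo, (~` G) (phi (t k)).
  by near=> k; case: (Ht k).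
by have [x [nGx /nGx]] := pcl _ G tG (OG _ pO).
Unshelve. all: by end_near.
Qed.

(** * Scalar convergence from decrease away from a level *)

(** The levels [c + k] and [c - k] cannot be crossed upwards at late times. A linear decrease brings
    [g] below the first; below the second it would go on to [-oo], against the recurrence above
    [w]. *)
Lemma strict_decrease_cvg (R : realType) (g : R -> R) (c w T0 : R) :
  (forall t, T0 <= t -> {for t, continuous g}) ->
  (forall k, 0 < k -> exists T d, d < 0 /\ forall a b, T <= a -> a <= b ->
    (forall t, a <= t <= b -> k <= `|g t - c|) -> g b - g a <= d * (b - a)) ->
  (forall T, exists2 t, T <= t & w <= g t) ->
  forall k, 0 < k -> exists T, forall t, T <= t -> `|g t - c| <= k.
Proof.
move=> gc gdec grec k k0.
have k20 : 0 < k / 2 by rewrite divr_gt0.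
(* The threshold [k / 2] leaves room: near a time where [|g - c| = k], continuity keeps
   [|g - c| >= k / 2]. *)
have [T1 [d [d0 dec]]] := gdec _ k20.
pose T := Num.max T0 T1.
have T0T : T0 <= T by rewrite le_max lexx.
have T1T : T1 <= T by rewrite le_max lexx orbT.
have gT t : T <= t -> {for t, continuous g}.
  by move=> Tt; apply: gc; exact: le_trans Tt.
have level l a b : `|l - c| = k -> T <= a -> a <= b -> g a <= l -> g b <= l.
  move=> lk Ta ab gal; apply: (le_barrier ab gal) => [t|s].
    by case/andP => at_ _; apply: gT; exact: le_trans at_.
  move=> /andP[as_ sb] gs.
  have cs : g @ s --> g s by apply: gT; exact: le_trans as_.
  have /nbhs_ballP[r /= r0 br] : \forall v \near s, `|g s - g v| <= k / 2.
    exact: (@cvgr_dist_le _ _ _ _ _ g (g s) cs _ k20).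
  exists r => // v /andP[sv vr] vb.
  have : g v - g s <= d * (v - s).
    apply: dec => // [|t /andP[st tv]]; first by lra.
    have : `|g s - g t| <= k / 2 by apply: br; rewrite /ball/= ltr_distl; lra.
    have := ler_distD (g t) (g s) c; rewrite gs lk; lra.
  have : d * (v - s) <= 0 by rewrite nmulr_rle0// subr_ge0.
  lra.
have [t1 Tt1 gt1] : exists2 t1, T <= t1 & g t1 <= c + k.
  apply: contrapT => nt.
  have big t : T <= t -> c + k < g t.
    by move=> Tt; rewrite ltNge; apply/negP => gtl; apply: nt; exists t.
  have gTc := big T (lexx _).
  (* At time [b], decrease at rate [d] from [g T] would have brought [g] down to [c]. *)
  pose b := T + (c - g T) / d.
  have Tb : T <= b.
    by rewrite lerDl ler_ndivlMr// mul0r; lra.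
  have : g b - g T <= d * (b - T).
    apply: dec => // t /andP[Tt _]; have := big _ Tt.
    by have := ler_norm (g t - c); lra.
  have -> : d * (b - T) = c - g T by rewrite /b; field; lra.
  have := big _ Tb; lra.
exists t1 => t t1t; rewrite ler_distl; apply/andP; split; last first.
  by apply: level gt1 => //; rewrite addrC addKr gtr0_norm.
rewrite leNgt; apply/negP => gtlt.
have Tt : T <= t by exact: le_trans t1t.
have small s : t <= s -> g s <= c - k.
  move=> ts; apply: level (ltW gtlt) => //.
  by rewrite addrC addKr normrN gtr0_norm.
(* By such a time the decrease from [g t] leaves [g] at most [w - 1]. *)
have [s ss ws] := grec (Num.max t (t + (w - 1 - g t) / d)).
have [ts ts'] : t <= s /\ t + (w - 1 - g t) / d <= s.
  by move: ss; rewrite ge_max => /andP.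
have : g s - g t <= d * (s - t).
  apply: dec => // [|v /andP[tv _]]; first exact: le_trans Tt.
  by have := small _ tv; have := ler_norm (c - g v); rewrite distrC; lra.
have : d * (s - t) <= w - 1 - g t.
  by rewrite mulrC -ler_ndivrMr//; lra.
lra.
Qed.

(** * Time spent near a point *)

(** At speed [K], the time [r / (4 * K)] covers a distance [r / 4]. This bound persists by
    [le_barrier]: where it is attained, [phi] is within [r / 2 + r / 4] of [y], so it stays in the
    ball a little longer and the speed bound still applies. *)
Lemma solution_stays_near (R : realType) (n : nat)
    (F : 'rV[R]_n -> set 'rV[R]_n) (phi : R -> 'rV[R]_n)
    (y : 'rV[R]_n) (K r t1 : R) :
  is_solution F phi -> 0 < K -> 0 < r -> 0 < t1 ->
  (forall x v, ball y r x -> F x v -> `|v| <= K) ->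
  `|y - phi t1| < r / 2 ->
  forall t, t1 <= t <= t1 + r / (4 * K) -> ball y r (phi t).
Proof.
move=> sol K0 r0 t10 FK yt1 t /andP[t1t tr].
have Kr s : s <= t -> K * (s - t1) <= r / 4.
  move=> st; have : K * (s - t1) <= K * (r / (4 * K)).
    by rewrite ler_pM2l//; lra.
  by rewrite (_ : K * (r / (4 * K)) = r / 4)//; field; lra.
suff : `|phi t - phi t1| - K * (t - t1) <= 0.
  rewrite -ball_normE /ball_/= => H; have := Kr _ (lexx t).
  have := ler_distD (phi t1) y (phi t); rewrite (distrC (phi t1)); lra.
apply: (@le_barrier _ (fun s => `|phi s - phi t1| - K * (s - t1)) t1 t) => //.
- by rewrite !subrr normr0 mulr0 subr0.
- move=> s s12; apply: cvgB.
    apply: cvg_norm; apply: cvgB; last exact: cvg_cst.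
    by apply: (solution_continuous sol); lra.
  by apply: cvgMr; apply: cvgB; [exact: cvg_id|exact: cvg_cst].
move=> s /andP[t1s st] hs.
have cs : phi @ s --> phi s by apply: (solution_continuous sol); lra.
have r4 : 0 < r / 4 by rewrite divr_gt0.
have /nbhs_ballP[e /= e0 be] : \forall v \near s, `|phi s - phi v| <= r / 4.
  exact: (@cvgr_dist_le _ _ _ _ _ phi (phi s) cs _ r4).
exists e => // v /andP[sv ve] vt.
have : `|phi v - phi s| <= K * (v - s).
  apply: (solution_speed_le sol) => //; first by lra.
  move=> q x /andP[sq qv]; apply: FK; rewrite -ball_normE /ball_/=.
  have : `|phi s - phi q| <= r / 4 by apply: be; rewrite /ball/= ltr_distl; lra.
  have := Kr _ (ltW st).
  have := ler_distD (phi t1) y (phi q).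
  have := ler_distD (phi s) (phi t1) (phi q).
  rewrite (distrC (phi t1) (phi s)); lra.
have := ler_distD (phi s) (phi v) (phi t1); lra.
Qed.

(** * Convergence of [W] along the solution, and the contradiction at [y] *)

Theorem propositionA1 (R : realType) (n : nat)
    (F : 'rV[R]_n -> set 'rV[R]_n) (phi : R -> 'rV[R]_n)
    (S O N : set 'rV[R]_n) (W : 'rV[R]_n -> R)
    (E := [set x | S x /\ lie_derivative N F W x 0]) :
  (forall x, upper_semicontinuous F x) ->
  (forall x, F x !=set0) ->
  (forall x, convex_set (F x)) ->
  (forall x, compact (F x)) ->
  is_solution F phi ->
  bounded_set (phi @` [set t | 0 <= t]) ->
  closed S ->
  embedded_submanifold S ->
  omega_limit phi `<=` S ->
  open O ->
  S `<=` O ->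
  locally_lipschitz_on O W ->
  (forall x, O x -> regular_at W x) ->
  lebesgue_null N ->
  (exists c : R, forall x, E x -> W x = c) ->
  (forall M : set 'rV[R]_n, compact M -> M `<=` S -> M `&` E = set0 ->
    exists (Mc : set 'rV[R]_n) (delta : R),
      [/\ compact Mc, M `<=` Mc°, Mc `<=` O, delta < 0 &
          (ereal_sup [set max_lie_derivative N F W x | x in Mc]
             <= delta%:E)%E]) ->
  omega_limit phi `<=` E.
Proof.
move=> uscF _ _ cF sol bphi _ _ OS oO SO lipW regW _ [c Wc] hypM y yO.
apply: contrapT => yE.
pose g := W \o phi.
have WcO x : O x -> {for x, continuous W}.
  exact: locally_lipschitz_continuous.
have omegaO x : omega_limit phi x -> O x by move=> /OS/SO.
have decr M : compact M -> M `<=` S -> M `&` E = set0 ->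
    exists Mc d, [/\ M `<=` Mc°, d < 0 & forall a b, 0 < a -> a <= b ->
      (forall t, a <= t <= b -> Mc (phi t)) -> g b - g a <= d * (b - a)].
  move=> cM MS ME; have [Mc [d [_ MMc McO d0 supd]]] := hypM M cM MS ME.
  exists Mc, d; split => // a b a0 ab phiMc.
  apply: (@solution_increment_le _ _ F phi O N W) => // [t tab|t l tab tl].
    exact/McO/phiMc.
  rewrite -lee_fin; apply: le_trans supd.
  apply: (@le_trans _ _ (max_lie_derivative N F W (phi t))).
    by apply: ereal_sup_ubound; exists l.
  by apply: ereal_sup_ubound; exists (phi t) => //; exact: phiMc.
have [T0 T0O] : exists T : R, forall t, T <= t -> O (phi t).
  apply: omega_limit_attracts => // x xO.
  by apply: open_nbhs_nbhs; split => //; exact: omegaO.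
have gcvg : forall k, 0 < k -> exists T, forall t, T <= t -> `|g t - c| <= k.
  (* The recurrence level [W y - 1] works because [phi] returns near [y]; the [1] in the maximum
     keeps times positive, where [phi] is continuous. *)
  apply: (@strict_decrease_cvg _ g c (W y - 1) (Num.max T0 1)).
  - move=> t; rewrite ge_max => /andP[T0t t1].
    apply: continuous_comp; last exact/WcO/T0O.
    by apply: (solution_continuous sol); exact: lt_le_trans t1.
  - move=> k k0.
    pose M := omega_limit phi `&` [set x | k <= `|W x - c|].
    have near_lt x : O x -> `|W x - c| < k -> \forall z \near x, `|W z - c| < k.
      move=> Ox xk; have cW : W @ x --> W x := WcO x Ox.
      have Wx : `|W z - c| @[z --> x] --> `|W x - c|.
        exact: (cvg_norm (cvgB cW (cvg_cst c))).
      exact: (cvgr_lt _ Wx _ xk).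
    have cM : compact M.
      (* [W] is known to be continuous only on [O], so a limit point [x] of [M] is first placed in
         the omega-limit set, hence in [O]. *)
      apply: (subclosed_compact _ (compact_omega_limit bphi)); last first.
        by move=> x [].
      move=> x clx; have xO : omega_limit phi x.
        by apply: closed_omega_limit => A /clx[z [[]]]; exists z.
      split => //=; rewrite leNgt; apply/negP => /near_lt.
      move=> /(_ (omegaO _ xO)) /clx[z [[_ /= kz]]]; rewrite ltNge kz.
      by [].
    have [||Mc [d [MMc d0 dec]]] := decr M cM.
    + by move=> x [/OS].
    + rewrite -subset0 => x [[_ /= kx] /Wc xc].
      by move: kx; rewrite xc subrr normr0 leNgt k0.
    have [T TG] : exists T : R, forall t, T <= t ->
        k <= `|W (phi t) - c| -> Mc (phi t).
      (* This set is a neighborhood of every omega-limit point: on [M] because [Mc] is one,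
         elsewhere because the premise fails nearby. *)
      apply: (@omega_limit_attracts _ _ _ [set x | k <= `|W x - c| -> Mc x]).
        by [].
      move=> x xO; have [kx|kx] := leP k `|W x - c|.
        have xMc : nbhs x Mc by exact: (MMc x (conj xO kx)).
        by apply: filterS xMc => z zM _.
      apply: filterS (near_lt _ (omegaO _ xO) kx) => z /=.
      by rewrite ltNge => /negbTE ->.
    exists (Num.max T 1), d; split => // a b.
    rewrite ge_max => /andP[Ta a1] ab gk; apply: dec => //.
      exact: lt_le_trans a1.
    move=> t tab; apply: TG; last exact: gk.
    by case/andP: tab => at_ _; exact: le_trans at_.
  - move=> T; have yWy : \forall z \near y, W y - 1 <= W z.
      have Wy : W @ y --> W y by exact: (WcO _ (omegaO _ yO)).
      by apply: (cvgr_ge _ Wy); rewrite gtrBl.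
    by have /omega_limitP/(_ T _ yWy)[t Tt [_ ?]] := yO; exists t.
have [||Mc [d [yMc d0 dec]]] := decr [set y] (@compact_set1 _ y).
- by move=> _ ->; exact: OS.
- by rewrite -subset0 => x [-> ].
have [K K0 [r1 r10 FK]] := usc_locally_bounded (uscF y) (cF y).
have /nbhs_ballP[r2 /= r20 r2Mc] : nbhs y Mc by apply: yMc.
pose r := Num.min r1 r2.
have r0 : 0 < r by rewrite lt_min r10.
have rr1 : r <= r1 by rewrite ge_min lexx.
have rr2 : r <= r2 by rewrite ge_min lexx orbT.
pose tau := r / (4 * K).
have tau0 : 0 < tau by rewrite divr_gt0// mulr_gt0.
(* During a stay of length [tau], [g] falls by at least [- (d * tau)], yet two values within a
   quarter of that from [c] differ by at most half of it. *)
have dtau : 0 < - (d * tau) / 4 by rewrite divr_gt0// oppr_gt0 nmulr_rlt0.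
have [T Tg] := gcvg _ dtau.
have rh0 : 0 < r / 2 by rewrite divr_gt0.
(* A single visit after [T] gives the contradiction; the radius [r / 2] is the one
   [solution_stays_near] starts from. *)
have /omega_limitP/(_ (Num.max T 1) _ (nbhsx_ballx y _ rh0)) := yO.
move=> [t1]; rewrite ge_max => /andP[Tt1 t11] [_ yt1].
have t10 : 0 < t1 by exact: lt_le_trans t11.
have stay := solution_stays_near sol K0 r0 t10.
have : g (t1 + tau) - g t1 <= d * (t1 + tau - t1).
  apply: dec => //; first by rewrite lerDl ltW.
  move=> t tt; apply: r2Mc; apply: le_ball rr2 _ _; apply: stay tt.
    by move=> x v yx; apply: FK; exact: le_ball rr1 _ yx.
  by move: yt1; rewrite -ball_normE.
have := Tg _ Tt1; have := Tg (t1 + tau); rewrite !ler_distl.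
move=> /(_ _)/wrap[|]; first by lra.
by rewrite (addrC t1) addrK; lra.
Qed.
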